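(* Let $(X,\tau)$ be an uncountable Polish space and $1\le\xi<\omega_1$. Then the rank $\alpha_\xi$ is unbounded in $\omega_1$ on the characteristic Baire class $\xi$ functions: for every $\zeta<\omega_1$ there is a set $A\subseteq X$ with $\chi_A$ of Baire class $\xi$ and $\alpha_\xi(\chi_A)\ge\zeta$.
   Context: A decreasing sequence $(F_\eta)_{\eta<\lambda}$ of subsets of $X$ is called continuous if $F_0=X$, $F_\eta=\bigcap_{\theta<\eta}F_\theta$ for limit $\eta<\lambda$, and $\bigcap_{\eta<\lambda}F_\eta=\emptyset$ if $\lambda$ is a limit; set $F_\eta=\emptyset$ for $\eta\ge\lambda$. Its transfinite difference is $\bigcup_{\eta<\lambda,\ \eta\text{ even}}(F_\eta\setminus F_{\eta+1})$. For disjoint $\boldsymbol\Pi^0_{\xi+1}$ sets $A,B\subseteq X$, $\alpha_\xi(A,B)$ is the least $\lambda$ such that there is such a continuous decreasing sequence $(F_\eta)_{\eta<\lambda}$ of $\boldsymbol\Pi^0_\xi$ sets whose transfinite difference $H$ separates $A$ and $B$ (i.e. $A\subseteq H\subseteq X\setminus B$). For a Baire class $\xi$ function $f$, $\alpha_\xi(f)=\sup\{\alpha_\xi(\{f\le p\},\{f\ge q\}):p<q,\ p,q\in\mathbb{Q}\}$. *)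

(* Defs.v *)
From HB Require Import structures.
From mathcomp Require Import all_boot all_order all_algebra.
From mathcomp Require wochoice.
From mathcomp Require Import all_classical all_reals all_analysis.

Set Implicit Arguments.
Unset Strict Implicit.
Unset Printing Implicit Defensive.

Import Order.TTheory GRing.Theory Num.Theory.
Import numFieldNormedType.Exports.

Local Open Scope classical_set_scope.
Local Open Scope ring_scope.

(* The countable ordinals are the points of a fixed well-ordering of [set nat]
that have only countably many predecessors.  This is a well-order all of
whose proper initial segments are countable and which is itself uncountable
([omega1_min], [omega1_countable_segment], [omega1_uncountable]), hence a copy
of the first uncountable ordinal. *)

Definition set_nat_wo : rel (set nat) :=
  projT1 (wochoice.well_ordering_principle (set nat)).

Lemma set_nat_woP : wochoice.well_order set_nat_wo.
Proof. exact: projT2 (wochoice.well_ordering_principle (set nat)). Qed.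

Lemma set_nat_wo_chain : wochoice.wo_chain set_nat_wo predT.
Proof. by move=> A _; exact: set_nat_woP. Qed.

Lemma set_nat_wo_refl : reflexive set_nat_wo.
Proof. by move=> x; apply: (wochoice.wo_chain_reflexive set_nat_wo_chain). Qed.

Lemma set_nat_wo_anti : antisymmetric set_nat_wo.
Proof. by move=> x y; apply: (wochoice.wo_chain_antisymmetric set_nat_wo_chain). Qed.

Lemma set_nat_wo_total : total set_nat_wo.
Proof. by move=> x y; apply: (wochoice.wo_chainW set_nat_wo_chain). Qed.

Lemma set_nat_wo_min (P : set (set nat)) : P !=set0 ->
  exists2 m, P m & forall y, P y -> set_nat_wo m y.
Proof.
move=> [x Px]; have [|m [[Pm mP] _]] := @set_nat_woP (fun z => `[< P z >]).
  by exists x; exact/asboolP.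
exists m; first exact/asboolP.
by move=> y Py; apply: mP; exact/asboolP.
Qed.

Lemma set_nat_wo_trans : transitive set_nat_wo.
Proof.
move=> y x z xy yz.
have [|m mP minP] := @set_nat_wo_min [set x; y; z].
  by exists x; left; left.
have mx := minP x (or_introl (or_introl erefl)).
have my := minP y (or_introl (or_intror erefl)).
have mz := minP z (or_intror erefl).
case: mP => [[]|] /= mE; rewrite mE in mx my mz *.
- by [].
- by rewrite (_ : x = y) //; apply: set_nat_wo_anti; rewrite xy mx.
- by rewrite (_ : z = y); [exact: xy | apply: set_nat_wo_anti; rewrite yz my].
Qed.

Definition set_nat_wo_segment (x : set nat) : set (set nat) :=
  [set y | set_nat_wo y x /\ y <> x].

Record omega1 := Omega1 {
  omega1_val : set nat ;
  _ : `[< countable (set_nat_wo_segment omega1_val) >] }.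

HB.instance Definition _ := [isSub for omega1_val].
HB.instance Definition _ := [Choice of omega1 by <:].

Definition omega1_le : rel omega1 :=
  fun x y => set_nat_wo (omega1_val x) (omega1_val y).

Fact omega1_le_refl : reflexive omega1_le.
Proof. by move=> x; exact: set_nat_wo_refl. Qed.

Fact omega1_le_anti : antisymmetric omega1_le.
Proof. by move=> x y /set_nat_wo_anti; exact: val_inj. Qed.

Fact omega1_le_trans : transitive omega1_le.
Proof. by move=> y x z; exact: set_nat_wo_trans. Qed.

Fact omega1_le_total : total omega1_le.
Proof. by move=> x y; exact: set_nat_wo_total. Qed.

Fact omega1_display : Order.disp_t. Proof. exact: Order.default_display. Qed.

HB.instance Definition _ := Order.Le_isPOrder.Build omega1_display omega1
  omega1_le_refl omega1_le_anti omega1_le_trans.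
HB.instance Definition _ :=
  Order.POrder_isTotal.Build omega1_display omega1 omega1_le_total.

Lemma omega1_min (P : set omega1) : P !=set0 ->
  exists2 m, P m & forall y, P y -> (m <= y)%O.
Proof.
move=> [x Px]; have [|_ [m Pm <-] mP] := @set_nat_wo_min (omega1_val @` P).
  by exists (omega1_val x), x.
by exists m => // y Py; apply: mP; exists y.
Qed.

Lemma omega1_inhabited : exists x : omega1, True.
Proof.
have [|m _ mP] := @set_nat_wo_min setT; first by exists set0.
have cm : `[< countable (set_nat_wo_segment m) >].
  apply/asboolP; rewrite (_ : set_nat_wo_segment m = set0) ?countable0//.
  rewrite -subset0 => y [ym]; apply; apply: set_nat_wo_anti.
  by rewrite ym mP.
by exists (Omega1 cm).
Qed.

Lemma omega1_ex_bottom : exists b : omega1, forall x : omega1, (b <= x)%O.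
Proof.
have [x _] := omega1_inhabited.
have [|b _ bP] := @omega1_min setT; first by exists x.
by exists b => y; exact: bP.
Qed.

HB.instance Definition _ := Order.hasBottom.Build omega1_display omega1
  (projT2 (cid omega1_ex_bottom)).

Lemma omega1_countable_segment (x : omega1) :
  countable [set y : omega1 | (y < x)%O].
Proof.
have /asboolP/countable_injP[f finj] := valP x.
apply/countable_injP; exists (f \o omega1_val) => y z /=.
have seg u : (u < x)%O -> set_nat_wo_segment (omega1_val x) (omega1_val u).
  by rewrite lt_neqAle => /andP[/eqP ux ule]; split=> // /val_inj.
rewrite !inE /= => /seg ys /seg zs fyz.
by apply: val_inj; apply: finj; rewrite ?inE.
Qed.

Lemma omega1_uncountable : ~ countable [set: omega1].
Proof.
move=> /countable_injP[g ginj].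
pose C := [set x | countable (set_nat_wo_segment x)].
have cC : countable C.
  apply/countable_injP; exists (fun x => oapp g 0%N (insub x)) => x y.
  rewrite !inE => /asboolT Cx /asboolT Cy.
  rewrite (insubT (fun x => `[< countable (set_nat_wo_segment x) >]) Cx).
  rewrite (insubT (fun x => `[< countable (set_nat_wo_segment x) >]) Cy) /=.
  by move=> /ginj; rewrite !in_setT => /(_ isT isT) [].
have [[z Cz]|allC] := pselect ((~` C) !=set0).
  have [|m Cm mP] := @set_nat_wo_min (~` C); first by exists z.
  apply: Cm; apply: sub_countable cC; apply: subset_card_le => y [ym ney].
  apply: contrapT => /mP my; apply: ney; apply: set_nat_wo_anti.
  by rewrite ym my.
have /countable_injP[f finj] : countable [set: set nat].
  rewrite (_ : [set: set nat] = C)//; apply/esym; rewrite -subTset => x _.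
  by apply: contrapT => nCx; apply: allC; exists x.
pose D := [set n | exists A, f A = n /\ ~ A n].
have nD : ~ D (f D).
  move=> [A [fAD nA]]; have AD : A = D by apply: finj; rewrite ?in_setT.
  by apply: (nA); rewrite AD; exists A.
by apply: (nD); exists D.
Qed.

(* The least element of [P]; the default value is used only for [P = set0]. *)
Definition omin (P : set omega1) : omega1 :=
  xget (\bot%O : omega1) [set m | P m /\ lbound P m].

Lemma ominP (P : set omega1) : P !=set0 -> P (omin P) /\ lbound P (omin P).
Proof.
by move=> /omega1_min[m Pm mP]; rewrite /omin; case: xgetP => [//|/(_ m)[]].
Qed.

Definition osucc (eta : omega1) : omega1 :=
  omin [set theta | (eta < theta)%O].

Lemma osuccP (eta : omega1) :
  (eta < osucc eta)%O /\ forall theta, (eta < theta)%O -> (osucc eta <= theta)%O.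
Proof.
apply: ominP; apply: contrapT => /forallNP noup; apply: omega1_uncountable.
have ub y : (y <= eta)%O by rewrite leNgt; apply/negP; exact: noup.
have /countable_injP[f finj] := omega1_countable_segment eta.
apply/countable_injP; exists (fun y => if (y < eta)%O then (f y).+1 else 0%N).
move=> y z _ _; have := ub y; have := ub z; rewrite !le_eqVlt.
case: ltP => [yl|_] /=; case: ltP => [zl|_] //=; rewrite ?orbF ?orbT.
  by move=> _ _ []; apply: finj; rewrite inE.
by move=> /eqP -> /eqP ->.
Qed.

Definition ozero : omega1 := \bot%O.
Definition oone : omega1 := osucc ozero.

Definition olimit (eta : omega1) : Prop :=
  (ozero < eta)%O /\ forall theta, (theta < eta)%O -> (osucc theta < eta)%O.

(* The even ordinals are those of the form [delta + 2 n] with [delta] zero or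
   a limit ordinal. *)
Inductive oeven : omega1 -> Prop :=
| oeven_zero : oeven ozero
| oeven_limit eta : olimit eta -> oeven eta
| oeven_succ2 eta : oeven eta -> oeven (osucc (osucc eta)).

Section Polish.
Variables (R : realType) (T : topologicalType).

Definition separable : Prop := exists2 D : set T, countable D & dense D.

Definition is_metric (d : T -> T -> R) : Prop :=
  [/\ forall x y, 0 <= d x y,
      forall x y, d x y = 0 <-> x = y,
      forall x y, d x y = d y x &
      forall x y z, d x z <= d x y + d y z].

Definition compatible_metric (d : T -> T -> R) : Prop :=
  forall (x : T) (A : set T),
    nbhs x A <-> exists2 e : R, 0 < e & [set y | d x y < e] `<=` A.

Definition complete_metric (d : T -> T -> R) : Prop :=
  forall u : nat -> T,
    (forall e : R, 0 < e -> exists N : nat,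
       forall m n : nat, (N <= m)%N -> (N <= n)%N -> d (u m) (u n) < e) ->
    exists l : T, u n @[n --> \oo] --> l.

Definition polish : Prop :=
  separable /\
  exists d : T -> T -> R,
    [/\ is_metric d, compatible_metric d & complete_metric d].

End Polish.

(* [Sigma0 xi] is the additive class of index [xi >= 1]: index one gives the
   open sets, and index [xi > 1] the countable unions of sets of smaller
   multiplicative classes. There are no sets of index zero. *)
Inductive Sigma0 (T : topologicalType) : omega1 -> set T -> Prop :=
| Sigma0_open (U : set T) : open U -> Sigma0 oone U
| Sigma0_bigcup (xi : omega1) (eta : nat -> omega1) (F : nat -> set T) :
    (forall n, (oone <= eta n)%O /\ (eta n < xi)%O) ->
    (forall n, Sigma0 (eta n) (~` F n)) ->
    Sigma0 xi (\bigcup_n F n).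

Definition Pi0 (T : topologicalType) (xi : omega1) (A : set T) : Prop :=
  Sigma0 xi (~` A).

Inductive baire_class (R : realType) (T : topologicalType) :
    omega1 -> (T -> R) -> Prop :=
| baire_class_continuous (f : T -> R) : continuous f -> baire_class ozero f
| baire_class_limit (xi : omega1) (eta : nat -> omega1) (g : nat -> T -> R)
    (f : T -> R) :
    (forall n, (eta n < xi)%O) ->
    (forall n, baire_class (eta n) (g n)) ->
    (forall x, g n x @[n --> \oo] --> f x) ->
    baire_class xi f.

Section Rank.
Variables (R : realType) (T : topologicalType).

(* A sequence of length [lambda] is given by a function on all of [omega1]
   that takes the value [set0] from [lambda] on. *)
Definition continuous_decreasing (lambda : omega1) (F : omega1 -> set T) : Prop :=
  [/\ (forall eta theta, (eta <= theta)%O -> (theta < lambda)%O ->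
         F theta `<=` F eta) /\
      (forall eta, (lambda <= eta)%O -> F eta = set0),
      F ozero = [set: T],
      forall eta, olimit eta -> (eta < lambda)%O ->
        F eta = \bigcap_(theta in [set theta | (theta < eta)%O]) F theta &
      olimit lambda ->
        \bigcap_(eta in [set eta | (eta < lambda)%O]) F eta = set0].

Definition transfinite_difference (lambda : omega1) (F : omega1 -> set T) : set T :=
  \bigcup_(eta in [set eta | (eta < lambda)%O /\ oeven eta])
    (F eta `\` F (osucc eta)).

(* For disjoint sets [A], [B] of class [Pi0 (osucc xi)] in a Polish space a
   separating sequence of countable length exists (Hausdorff-Kuratowski), so
   that the default value [ozero] of [omin] does not come into play. *)
Definition alpha_sep (xi : omega1) (A B : set T) : omega1 :=
  omin [set lambda | exists F : omega1 -> set T,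
    [/\ continuous_decreasing lambda F,
        forall eta, (eta < lambda)%O -> Pi0 xi (F eta),
        A `<=` transfinite_difference lambda F &
        transfinite_difference lambda F `<=` ~` B]].

Definition alpha_rank (xi : omega1) (f : T -> R) : omega1 :=
  supremum ozero [set alpha |
    exists p q : rat, p < q /\
      alpha = alpha_sep xi [set x | f x <= ratr p] [set x | ratr q <= f x]].

End Rank.

(* Main.v *)
(* A is obtained by diagonalization. A Cantor scheme in X gives a closed set K and a continuous
   map g from K onto the Cantor space, so that a point of K codes a sequence of length zeta of
   Pi0_xi sets through a universal set. A continuous decreasing sequence F is determined by its
   values at successors, F_eta = \bigcap_(theta < eta) F_(theta + 1), and conversely every sequence
   G of Pi0_xi sets yields such a sequence E_eta = \bigcap_(theta < eta) G_theta. Let G_theta be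
   the set of those x in K that lie in the theta-th set they code, and A the difference of the
   resulting E. If the complement of A were the difference of some F of length < zeta, a point x
   coding F would satisfy x \in E_eta <-> x \in F_eta for all eta, hence x \in A <-> x \notin A.
   The complement of A is again a difference, of the sequence \bigcap_(theta < eta) E_theta, which
   repeats E at limits and thereby exchanges the parities. Hence alpha_xi takes a true value
   (not the default), and A is ambiguous of class xi + 1, so that its characteristic function is
   of Baire class xi by the Lebesgue-Hausdorff theorem. *)
Require Import Defs.
From mathcomp Require Import all_boot all_order all_algebra.
From mathcomp Require Import all_classical all_reals all_analysis.
From mathcomp Require Import lra.
Set Implicit Arguments.
Unset Strict Implicit.
Unset Printing Implicit Defensive.
Import Order.TTheory GRing.Theory Num.Theory.
Import numFieldNormedType.Exports.

Local Open Scope classical_set_scope.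
Local Open Scope ring_scope.

Lemma countable_eq_range (T : choiceType) (A : set T) : countable A -> A !=set0 ->
  exists e : nat -> T, A = range e.
Proof.
move=> /countable_injP[f finj] [a Aa].
exists (fun n => xget a [set x | A x /\ f x = n]).
apply/seteqP; split=> [x Ax|_ [n _ <-]].
  exists (f x) => //; case: xgetP => [y _ [Ay fyx]|/(_ x)]; last by case.
  by apply: finj => //; rewrite inE.
by case: xgetP => [y _ []|].
Qed.

(** * Ordinals and transfinite differences *)

Lemma omega1_ind (P : omega1 -> Prop) :
  (forall x, (forall y, (y < x)%O -> P y) -> P x) -> forall x, P x.
Proof.
move=> Pind x; apply: contrapT => nPx.
have [|m nPm mP] := @omega1_min [set y | ~ P y]; first by exists x.
apply: nPm; apply: Pind => y ym; apply: contrapT => /mP.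
by rewrite leNgt ym.
Qed.

Lemma ozero_le x : (ozero <= x)%O. Proof. exact: Order.le0x. Qed.

Lemma lt_osucc x : (x < osucc x)%O. Proof. by case: (osuccP x). Qed.

Lemma osucc_leE x y : (osucc x <= y)%O = (x < y)%O.
Proof.
apply/idP/idP; first exact: lt_le_trans (lt_osucc x).
by case: (osuccP x) => _; apply.
Qed.

Lemma lt_osuccE x y : (x < osucc y)%O = (x <= y)%O.
Proof. by rewrite ltNge osucc_leE -leNgt. Qed.

Lemma osucc_inj : injective osucc.
Proof.
by move=> x y xy; apply/le_anti; rewrite -!lt_osuccE xy lt_osucc -xy lt_osucc.
Qed.

Lemma osucc_neq0 x : osucc x <> ozero.
Proof. by move=> x0; have := lt_osucc x; rewrite x0 ltNge ozero_le. Qed.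

Lemma olimit_osucc x : ~ olimit (osucc x).
Proof. by move=> [_ /(_ x (lt_osucc x))]; rewrite ltxx. Qed.

Lemma omega1_cases x : x = ozero \/ olimit x \/ exists y, x = osucc y.
Proof.
have [->|x0] := pselect (x = ozero); first by left.
right; have [[y xy]|nsucc] := pselect (exists y, x = osucc y).
  by right; exists y.
left; split=> [|y yx]; first by rewrite lt_neqAle ozero_le andbT eq_sym; apply/eqP.
rewrite lt_neqAle osucc_leE yx andbT; apply/eqP => yx'; apply: nsucc.
by exists y.
Qed.

Lemma oeven_or_succ x : oeven x \/ oeven (osucc x).
Proof.
elim/omega1_ind: x => x IH; have [->|[lx|[y xy]]] := omega1_cases x.
- by left; exact: oeven_zero.
- by left; exact: oeven_limit.
- have [|ey|ey] := IH y; first by rewrite xy lt_osucc.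
    by right; rewrite xy; exact: oeven_succ2.
  by left; rewrite xy.
Qed.

Lemma oeven_succ_inv x : oeven (osucc x) -> exists2 y, x = osucc y & oeven y.
Proof.
move=> ex; inversion ex as [x0|e le|y ey yx]; last by exists y => //; exact/esym/osucc_inj.
  by case: (@osucc_neq0 x).
by case: (olimit_osucc le).
Qed.

Lemma oevenN x : oeven x -> ~ oeven (osucc x).
Proof.
elim/omega1_ind: x => x IH ex /oeven_succ_inv[y xy ey].
by apply: (IH y) => //; rewrite ?xy ?lt_osucc// -xy.
Qed.

(** Otherwise the segments below the points of [C] would cover [omega1], a countable union of
    countable sets. *)
Lemma countable_has_ubound (C : set omega1) : countable C -> has_ubound C.
Proof.
move=> cC; apply: contrapT => /forallNP nub; apply: omega1_uncountable.
apply: sub_countable (bigcup_countable cC (fun x _ => omega1_countable_segment x)).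
apply: subset_card_le => y _.
have /existsNP[x /not_implyP[Cx /negP]] := nub y.
by rewrite -ltNge => yx; exists x.
Qed.

(** Boundedness makes [supremum] a genuine least upper bound: well-ordering gives a least element of
    [ubound C], which excludes the default of [xget]. *)
Lemma le_supremum (C : set omega1) z a : has_ubound C -> C a ->
  (z <= a)%O -> (z <= supremum ozero C)%O.
Proof.
move=> [u uC] Ca za; apply: le_trans za _; rewrite /supremum.
have -> : (C == set0) = false by apply/negbTE/set0P; exists a.
case: xgetP => [s _ [+ _]|]; first exact.
have [|m um mP /(_ m) []] := @omega1_min (ubound C); first by exists u.
by split.
Qed.

(** * Normal form of continuous decreasing sequences *)

Section DecreasingIntersections.
Variable T : Type.
Implicit Types G E F : omega1 -> set T.

(** For arbitrary [G], monotonicity, the value at zero and continuity at limits hold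
    automatically. *)
Definition ocap G (eta : omega1) : set T :=
  \bigcap_(theta in [set theta | (theta < eta)%O]) G theta.

(** Free of the length, so that sequences of different lengths can be compared. It agrees with
    [transfinite_difference] once [F] vanishes from the length on. *)
Definition even_difference F : set T :=
  \bigcup_(eta in oeven) (F eta `\` F (osucc eta)).

Lemma ocap0 G : ocap G ozero = setT.
Proof. by rewrite -subTset => x _ t /=; rewrite ltNge ozero_le. Qed.

Lemma ocap_decr G eta theta : (eta <= theta)%O -> ocap G theta `<=` ocap G eta.
Proof. by move=> et x Gx t /= te; apply: Gx => /=; apply: lt_le_trans et. Qed.

Lemma ocap_limit G eta : olimit eta -> ocap G eta = ocap (ocap G) eta.
Proof.
move=> [_ le]; apply/seteqP; split=> x Gx t /= te; first by apply: ocap_decr Gx; apply: ltW.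
by apply: (Gx (osucc t) (le _ te)); exact: lt_osucc.
Qed.

Lemma ocap_ocapS G eta : ocap (ocap G) (osucc eta) = ocap G eta.
Proof.
apply/seteqP; split=> [x|x Gx t /=]; first by apply; exact: lt_osucc.
by rewrite lt_osuccE => te; exact: ocap_decr Gx.
Qed.

(** Let [m] be the first index with [x] outside [ocap G m]; it exists because [G] vanishes from [z]
    on. The difference of [ocap G] contains [x] iff [m] is the successor of an even ordinal, that of
    [ocap (ocap G)] iff [m] itself is even. *)
Lemma setC_even_difference_ocap G z : (forall theta, (z <= theta)%O -> G theta = set0) ->
  ~` even_difference (ocap G) = even_difference (ocap (ocap G)).
Proof.
move=> G0; apply/seteqP; split=> [x nx|x [eta ee []]].
  have [|m nm mP] := @omega1_min [set eta | ~ ocap G eta x].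
    by exists (osucc z) => /(_ z (lt_osucc z)); rewrite G0.
  have mG t : (t < m)%O -> ocap G t x.
    by move=> tm; apply: contrapT => /mP; rewrite leNgt tm.
  have em : oeven m.
    have [m0|[lm|[s ms]]] := omega1_cases m.
    - by move: nm; rewrite m0 /= ocap0 => /(_ I).
    - exact: oeven_limit.
    - rewrite ms; case: (oeven_or_succ s) => // es; exfalso; apply: nx.
      by exists s => //; split; [apply: mG; rewrite ms lt_osucc|rewrite -ms].
  by exists m => //; split=> //; rewrite ocap_ocapS.
rewrite ocap_ocapS => Gx nGx [s es [Gsx nGsx]].
(* Both [eta] and [osucc s] are the first index at which [x] has left [ocap G]. *)
have eta_s : eta = osucc s.
  apply/le_anti/andP; split; rewrite leNgt; apply/negP => h; first exact: nGsx (Gx _ h).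
  by apply: nGx; apply: ocap_decr Gsx; rewrite -lt_osuccE.
by apply: (oevenN es); rewrite -eta_s.
Qed.

End DecreasingIntersections.

Section ContinuousDecreasing.
Variable T : topologicalType.
Implicit Types F G : omega1 -> set T.

(** Successors are cofinal in a limit, so continuity recovers every value from those at successors.
    The diagonal argument compares sequences through this formula. *)
Lemma continuous_decreasing_ocap (lambda : omega1) F : continuous_decreasing lambda F ->
  F = ocap (fun theta => F (osucc theta)).
Proof.
move=> [[Fdecr F0] FT Flim Flam]; apply/funext => eta.
have decr e t : (e <= t)%O -> F t `<=` F e.
  move=> et; case: (ltP t lambda) => [tl|/F0 -> x//]; exact: Fdecr.
have [->|[le|[s ->]]] := omega1_cases eta.
- by rewrite ocap0.
- have Fe : F eta = ocap F eta.
    (* Below [lambda] this is continuity; beyond it the term of index [lambda] is already empty; at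
       [lambda] it is the clause on limit lengths. *)
    case: (ltgtP eta lambda) => [/(Flim _ le)//|le'|el].
      rewrite F0 ?ltW//; apply/esym; rewrite -subset0 => x /(_ lambda le').
      by rewrite F0.
    by rewrite F0 ?el//; apply/esym/Flam; rewrite -el.
  apply/seteqP; split=> x.
    by move=> Fx t /= te; apply: decr Fx; rewrite osucc_leE.
  by move=> h; rewrite Fe => t te; apply: decr (h t te); apply/ltW/lt_osucc.
- apply/seteqP; split=> x; last by apply; exact: lt_osucc.
  by move=> Fx t /= te; apply: decr Fx; rewrite osucc_leE.
Qed.

Lemma transfinite_difference_even (lambda : omega1) F :
  (forall eta, (lambda <= eta)%O -> F eta = set0) ->
  transfinite_difference lambda F = even_difference F.
Proof.
move=> F0; apply/seteqP; split=> x [e]; first by move=> [_ ee] h; exists e.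
move=> ee h; exists e => //; split=> //.
by rewrite ltNge; apply/negP => /F0 Fe; move: h; rewrite Fe => -[].
Qed.

(** The length is [osucc z] because [ocap G z] may be nonempty, [G z] being first used at the next
    index. At a successor length the clause on limit lengths is vacuous. *)
Lemma ocap_continuous_decreasing (z : omega1) G :
  (forall theta, (z <= theta)%O -> G theta = set0) ->
  continuous_decreasing (osucc z) (ocap G).
Proof.
move=> G0; split.
- split=> [e t et _|e]; first exact: ocap_decr.
  by rewrite osucc_leE => ze; rewrite -subset0 => x /(_ z ze); rewrite G0.
- exact: ocap0.
- by move=> e le _; exact: ocap_limit.
- by move=> /olimit_osucc.
Qed.

End ContinuousDecreasing.

(** * Metric spaces *)

Section MetricTopology.
Variables (R : realType) (T : topologicalType) (d : T -> T -> R).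
Hypotheses (md : is_metric d) (cd : compatible_metric d).

Let d_ge0 x y : 0 <= d x y. Proof. by case: md. Qed.
Let d_eq0 x y : d x y = 0 <-> x = y. Proof. by case: md. Qed.
Let d_sym x y : d x y = d y x. Proof. by case: md. Qed.
Let d_tri x y z : d x z <= d x y + d y z. Proof. by case: md. Qed.
Let d_xx x : d x x = 0. Proof. exact/d_eq0. Qed.

Lemma lipschitz1_continuous (f : T -> R) :
  (forall x y, f x <= f y + d x y) -> continuous f.
Proof.
move=> flip x; apply/cvgrPdist_le => /= e e0; apply/cd; exists e => // y /= xy.
have := flip x y; have := flip y x; rewrite (d_sym y x) => h1 h2.
rewrite ler_norml; apply/andP; split; lra.
Qed.

Lemma closed_metric_ball x r : closed [set y | d x y <= r].
Proof.
have -> : [set y | d x y <= r] = d x @^-1` [set t | t <= r] by [].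
apply: preimage_closed; last exact: closed_le.
move=> y _; apply: lipschitz1_continuous => {}y z.
by rewrite addrC (d_sym y z) addrC; exact: d_tri.
Qed.

Lemma metric_ball_nbhs x r : 0 < r -> nbhs x [set y | d x y < r].
Proof. by move=> r0; apply/cd; exists r. Qed.

(* Capping the distance by [1] makes the infimum range over a nonempty set even
   when [F] is empty. *)
Definition set_dist (F : set T) (x : T) : R :=
  inf [set t | t = 1 \/ exists2 y, F y & t = d x y].

Lemma set_dist_has_inf F x : has_inf [set t | t = 1 \/ exists2 y, F y & t = d x y].
Proof.
split; first by exists 1; left.
by exists 0 => t [->|[y _ ->]]//; exact: ler01.
Qed.

Lemma set_dist_ge0 F x : 0 <= set_dist F x.
Proof.
apply: lb_le_inf; first by case: (set_dist_has_inf F x).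
by move=> t [->|[y _ ->]]//; exact: ler01.
Qed.

Lemma set_dist_continuous F : continuous (set_dist F).
Proof.
apply: lipschitz1_continuous => x y; rewrite -lerBlDr.
apply: lb_le_inf; first by case: (set_dist_has_inf F y).
have le t : t = 1 \/ (exists2 y, F y & t = d x y) -> set_dist F x <= t.
  by move=> ht; apply: ge_inf => //; case: (set_dist_has_inf F x).
move=> t [->|[z Fz ->]]; rewrite lerBlDr.
  by apply: le_trans (le 1 _) _; [left|rewrite lerDl].
by apply: le_trans (le (d x z) _) _; [right; exists z|rewrite addrC].
Qed.

Lemma set_dist_mem F x : F x -> set_dist F x = 0.
Proof.
move=> Fx; apply/le_anti; rewrite set_dist_ge0 andbT.
apply: ge_inf; first by case: (set_dist_has_inf F x).
by right; exists x => //; rewrite d_xx.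
Qed.

Lemma set_dist_gt0 F x : closed F -> ~ F x -> 0 < set_dist F x.
Proof.
move=> cF nFx; have : nbhs x (~` F) by apply: open_nbhs_nbhs; split=> //; exact: closed_openC.
move=> /cd[e e0 eF]; apply: (@lt_le_trans _ _ (Num.min 1 e)).
  by rewrite lt_min ltr01.
apply: lb_le_inf; first by case: (set_dist_has_inf F x).
move=> t [->|[y Fy ->]]; first by rewrite ge_min lexx.
rewrite ge_min; apply/orP; right; rewrite leNgt; apply/negP => /eF.
exact.
Qed.

Lemma metric_urysohn F G : closed F -> closed G -> F `&` G = set0 ->
  exists f : T -> R, [/\ continuous f, forall x, F x -> f x = 1 &
    forall x, G x -> f x = 0].
Proof.
move=> cF cG FG.
have den x : set_dist F x + set_dist G x != 0.
  rewrite paddr_eq0 ?set_dist_ge0//; apply/negP => /andP[/eqP F0 /eqP G0].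
  have Fx : F x by apply: contrapT => /(set_dist_gt0 cF); rewrite F0 ltxx.
  have Gx : G x by apply: contrapT => /(set_dist_gt0 cG); rewrite G0 ltxx.
  by have : (F `&` G) x by []; rewrite FG.
exists (fun x => set_dist G x / (set_dist F x + set_dist G x)); split.
- move=> x; apply: cvgM; first exact: set_dist_continuous.
  apply: cvgV => //; apply: cvgD; exact: set_dist_continuous.
- move=> x Fx; have := den x; rewrite (set_dist_mem Fx) add0r => g0.
  by rewrite divff.
- by move=> x Gx; rewrite (set_dist_mem Gx) mul0r.
Qed.

Lemma metric_open_Fsigma U : open U ->
  exists2 F : nat -> set T, (forall n, closed (F n)) & U = \bigcup_n F n.
Proof.
move=> oU; exists (fun n => [set x | n.+1%:R^-1 <= set_dist (~` U) x]).
  move=> n; have -> : [set x | n.+1%:R^-1 <= set_dist (~` U) x] =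
    set_dist (~` U) @^-1` [set t | n.+1%:R^-1 <= t] by [].
  by apply: preimage_closed; [move=> x _; exact: set_dist_continuous|exact: closed_ge].
apply/seteqP; split=> [x Ux|x [n _ /= nx]].
  have x0 : 0 < set_dist (~` U) x.
    by apply: set_dist_gt0; [exact: open_closedC|].
  have [n _ nP] := near_infty_natSinv_lt (PosNum x0).
  by exists n => //=; apply/ltW; exact: (nP n (leqnn n)).
apply: contrapT => nUx; move: nx; rewrite set_dist_mem// leNgt invr_gt0 ltr0n//.
Qed.

Lemma separable_countable_base : separable T -> [set: T] !=set0 ->
  exists2 B : nat -> set T, (forall n, open (B n)) &
    forall x (V : set T), nbhs x V -> exists2 n, B n x & B n `<=` V.
Proof.
move=> [D cD dD] [t0 _].
have Dn0 : D !=set0.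
  by have [|x [_ Dx]] := dD setT _ openT; [exists t0|exists x].
have [e De] := countable_eq_range cD Dn0.
pose ball x (r : R) := [set y | d x y < r].
have ball_open x r : open (ball x r).
  have -> : ball x r = d x @^-1` [set t | t < r] by [].
  apply: open_comp; last exact: open_lt.
  move=> y _; apply: lipschitz1_continuous => {}y z.
  by rewrite addrC (d_sym y z) addrC; exact: d_tri.
pose B n := if @unpickle (nat * nat)%type n is Some (i, j) then
  ball (e i) j.+1%:R^-1 else set0.
exists B.
  by move=> n; rewrite /B; case: unpickle => [[i j]|]; [exact: ball_open|exact: open0].
move=> x V /cd[r r0 rV].
have r20 : 0 < r / 2 by rewrite divr_gt0.
have [j jr] : exists j, j.+1%:R^-1 < r / 2.
  have [n _ nP] := near_infty_natSinv_lt (PosNum r20).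
  by exists n; exact: (nP n (leqnn n)).
have [|y [xy Dy]] := dD (ball x j.+1%:R^-1) _ (ball_open _ _).
  by exists x; rewrite /ball /= d_xx invr_gt0.
have [i _ iy] : range e y by rewrite -De.
exists (pickle (i, j)); rewrite /B pickleK /ball/= iy; first by rewrite d_sym.
move=> z /= yz; apply: rV => /=; apply: le_lt_trans (d_tri x y z) _.
by rewrite (splitr r) ltrD//; apply: lt_trans jr.
Qed.

End MetricTopology.

(** * Borel classes *)

Lemma bigcup2_unpickle (T : Type) (S : nat -> nat -> set T) :
  \bigcup_i \bigcup_j S i j =
  \bigcup_n (let ij := odflt (0, 0)%N (unpickle n) in S ij.1 ij.2).
Proof.
apply/seteqP; split=> [x [i _ [j _ Sx]]|x [n _ Sx]].
  by exists (pickle (i, j)) => //=; rewrite pickleK.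
by exists (odflt (0, 0)%N (unpickle n)).1 => //; exists (odflt (0, 0)%N (unpickle n)).2.
Qed.

Section BorelClasses.
Variable T : topologicalType.
Hypothesis open_Fsigma : forall U : set T, open U ->
  exists2 F : nat -> set T, (forall n, closed (F n)) & U = \bigcup_n F n.
Implicit Types (A B : set T) (xi eta : omega1).

Lemma Sigma0_oone A : Sigma0 oone A <-> open A.
Proof.
split=> [h|]; last exact: Sigma0_open.
inversion h as [|xi eta F bnd SF]; first by [].
by have [h1 h2] := bnd 0%N; move: h2; rewrite ltNge h1.
Qed.

Lemma Sigma0_index xi A : Sigma0 xi A -> (oone <= xi)%O.
Proof.
case=> [U _|{}xi eta F bnd _]; first exact: lexx.
by have [h1 h2] := bnd 0%N; apply/ltW/(le_lt_trans h1).
Qed.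

Lemma closed_Pi0 A : closed A -> Pi0 oone A.
Proof. by move=> cA; apply/Sigma0_open/closed_openC. Qed.

Lemma Pi0_Sigma0 eta xi A : (eta < xi)%O -> Pi0 eta A -> Sigma0 xi A.
Proof.
move=> ex PA; have -> : A = \bigcup_(n : nat) A by rewrite bigcup_const//; exists 0%N.
apply: (@Sigma0_bigcup _ _ (fun=> eta)) => n //.
by split=> //; exact: Sigma0_index PA.
Qed.

Lemma Sigma0_gt1P xi A : (oone < xi)%O -> Sigma0 xi A <->
  exists F : nat -> set T, A = \bigcup_n F n /\
    forall n, exists2 eta, (oone <= eta < xi)%O & Pi0 eta (F n).
Proof.
move=> x1; split=> [h|[F [-> FP]]].
  inversion h as [U oU xi1|x eta F bnd SF]; first by move: x1; rewrite -xi1 ltxx.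
  by exists F; split=> // n; exists (eta n) => //; apply/andP; case: (bnd n).
have /choice[eta etaP] : forall n, exists eta, (oone <= eta < xi)%O /\ Pi0 eta (F n).
  by move=> n; have [e] := FP n; exists e.
apply: (@Sigma0_bigcup _ _ eta) => n; have [/andP[] ] := etaP n; by [].
Qed.

(** The step out of index one is where [open_Fsigma] enters: higher classes are built from closed
    sets, so an open set must be a countable union of these. *)
Lemma Sigma0_le eta xi A : (eta <= xi)%O -> Sigma0 eta A -> Sigma0 xi A.
Proof.
rewrite le_eqVlt => /predU1P[->//|ex SA].
have x1 : (oone < xi)%O by apply: le_lt_trans ex; exact: Sigma0_index SA.
have [e1|e1] := eqVneq eta oone.
  apply/(Sigma0_gt1P _ x1).
  move: SA; rewrite e1 => /Sigma0_oone /open_Fsigma[F cF ->]; exists F; split=> // n.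
  by exists oone; [rewrite lexx|exact: closed_Pi0].
have {}e1 : (oone < eta)%O by rewrite lt_neqAle eq_sym e1; exact: Sigma0_index SA.
move/(Sigma0_gt1P _ e1): SA => [F [-> FP]]; apply/(Sigma0_gt1P _ x1); exists F; split=> // n.
have [t /andP[t1 te] Pt] := FP n; exists t => //.
by rewrite t1 (lt_trans te).
Qed.

Lemma Pi0_le eta xi A : (eta <= xi)%O -> Pi0 eta A -> Pi0 xi A.
Proof. exact: Sigma0_le. Qed.

Lemma open_Sigma0 xi A : (oone <= xi)%O -> open A -> Sigma0 xi A.
Proof. by move=> x1 oA; apply: Sigma0_le x1 _; exact: Sigma0_open. Qed.

Lemma Sigma0_bigcup_nat xi (S : nat -> set T) :
  (forall n, Sigma0 xi (S n)) -> Sigma0 xi (\bigcup_n S n).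
Proof.
move=> SS; have := Sigma0_index (SS 0%N); rewrite le_eqVlt => /predU1P[x1|x1].
  move: SS; rewrite -x1 => SS; apply: Sigma0_open; apply: bigcup_open => n _.
  exact/Sigma0_oone.
have /choice[F FP] : forall n, exists F : nat -> set T, S n = \bigcup_m F m /\
    forall m, exists2 eta, (oone <= eta < xi)%O & Pi0 eta (F m).
  by move=> n; exact/(Sigma0_gt1P _ x1).
rewrite (_ : \bigcup_n S n = \bigcup_n \bigcup_m F n m); last first.
  by apply: eq_bigcupr => n _; case: (FP n).
rewrite bigcup2_unpickle; apply/(Sigma0_gt1P _ x1); eexists; split; first by [].
by move=> n /=; case: (FP (odflt (0, 0)%N (unpickle n)).1) => _; exact.
Qed.

Lemma Sigma0_bigcup_countable (I : choiceType) xi (D : set I) (S : I -> set T) :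
  (oone <= xi)%O -> countable D -> (forall i, D i -> Sigma0 xi (S i)) ->
  Sigma0 xi (\bigcup_(i in D) S i).
Proof.
move=> x1 cD SS; have [D0|/set0P D0] := eqVneq D set0.
  by rewrite D0 bigcup_set0; apply: open_Sigma0 => //; exact: open0.
have [e De] := countable_eq_range cD D0.
rewrite De bigcup_image; apply: Sigma0_bigcup_nat => n; apply: SS.
by rewrite De; exists n.
Qed.

Lemma Pi0_bigcap_countable (I : choiceType) xi (D : set I) (S : I -> set T) :
  (oone <= xi)%O -> countable D -> (forall i, D i -> Pi0 xi (S i)) ->
  Pi0 xi (\bigcap_(i in D) S i).
Proof. by move=> x1 cD SS; rewrite /Pi0 setC_bigcap; exact: Sigma0_bigcup_countable. Qed.

Lemma Sigma0_setU xi A B : Sigma0 xi A -> Sigma0 xi B -> Sigma0 xi (A `|` B).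
Proof.
move=> SA SB; rewrite -bigcup2E; apply: Sigma0_bigcup_nat => -[|[|n]] //=.
by apply: open_Sigma0; [exact: Sigma0_index SA|exact: open0].
Qed.

Lemma Pi0_setI xi A B : Pi0 xi A -> Pi0 xi B -> Pi0 xi (A `&` B).
Proof. by rewrite /Pi0 setCI; exact: Sigma0_setU. Qed.

(** Above index one, distribute the unions: two pieces of multiplicative classes below [xi] meet in
    a set whose class is the larger of the two, still below [xi]. *)
Lemma Sigma0_setI xi A B : Sigma0 xi A -> Sigma0 xi B -> Sigma0 xi (A `&` B).
Proof.
move=> SA SB; have := Sigma0_index SA; rewrite le_eqVlt => /predU1P[x1|x1].
  by move: SA SB; rewrite -x1 !Sigma0_oone; exact: openI.
move/(Sigma0_gt1P _ x1): SA => [F [-> FP]].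
move/(Sigma0_gt1P _ x1): SB => [G [-> GP]].
rewrite setI_bigcupl.
under eq_bigcupr do rewrite setI_bigcupr.
apply: Sigma0_bigcup_nat => n; apply: Sigma0_bigcup_nat => m.
have [e /andP[e1 ex] Pe] := FP n; have [t /andP[t1 tx] Pt] := GP m.
apply: (@Pi0_Sigma0 (Order.max e t)); first by rewrite gt_max ex.
by apply: Pi0_setI; [apply: Pi0_le Pe|apply: Pi0_le Pt]; rewrite le_max lexx ?orbT.
Qed.

Lemma ocap_Pi0 xi (G : omega1 -> set T) eta : (oone <= xi)%O ->
  (forall theta, Pi0 xi (G theta)) -> Pi0 xi (ocap G eta).
Proof.
by move=> x1 PG; apply: Pi0_bigcap_countable => //; exact: omega1_countable_segment.
Qed.

(** Only the countably many indices below [z] contribute, and a difference of two [Pi0 xi] sets is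
    of class [Sigma0 (osucc xi)]. *)
Lemma even_difference_Sigma0 xi z (F : omega1 -> set T) : (oone <= xi)%O ->
  (forall theta, (z <= theta)%O -> F theta = set0) ->
  (forall theta, Pi0 xi (F theta)) -> Sigma0 (osucc xi) (even_difference F).
Proof.
move=> x1 F0 PF.
have -> : even_difference F =
    \bigcup_(e in [set e | (e < z)%O /\ oeven e]) (F e `\` F (osucc e)).
  exact/esym/transfinite_difference_even.
apply: Sigma0_bigcup_countable.
- exact: le_trans (ltW (lt_osucc xi)).
- by apply: sub_countable (omega1_countable_segment z); apply: subset_card_le => y [].
move=> e _; apply: Sigma0_setI; first exact: Pi0_Sigma0 (lt_osucc _) _.
by apply: Sigma0_le (PF _); exact/ltW/lt_osucc.
Qed.

End BorelClasses.

(** * The Lebesgue-Hausdorff theorem for characteristic functions *)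

Section LebesgueHausdorff.
Variables (R : realType) (T : topologicalType).
Hypothesis open_Fsigma : forall U : set T, open U ->
  exists2 F : nat -> set T, (forall n, closed (F n)) & U = \bigcup_n F n.
Hypothesis urysohn : forall F G : set T, closed F -> closed G -> F `&` G = set0 ->
  exists f : T -> R, [/\ continuous f, forall x, F x -> f x = 1 &
    forall x, G x -> f x = 0].
Implicit Types (A B : set T) (xi eta : omega1).

(** These sets form an algebra, and the induction hypothesis of the Lebesgue-Hausdorff theorem makes
    their characteristic functions of some class below [xi]. *)
Definition ambiguous_below xi A := exists eta, [/\ (oone <= eta)%O, (eta < xi)%O,
  Sigma0 (osucc eta) A & Pi0 (osucc eta) A].

Lemma ambiguous_belowC xi A : ambiguous_below xi A -> ambiguous_below xi (~` A).
Proof. by move=> [e [e1 ex SA PA]]; exists e; split=> //; rewrite /Pi0 setCK. Qed.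

Lemma ambiguous_belowU xi A B :
  ambiguous_below xi A -> ambiguous_below xi B -> ambiguous_below xi (A `|` B).
Proof.
move=> [e [e1 ex SA PA]] [t [t1 tx SB PB]]; exists (Order.max e t).
have et : (osucc e <= osucc (Order.max e t))%O by rewrite osucc_leE lt_osuccE le_max lexx.
have tt : (osucc t <= osucc (Order.max e t))%O by rewrite osucc_leE lt_osuccE le_max lexx orbT.
split.
- by rewrite le_max e1.
- by rewrite gt_max ex.
- by apply: Sigma0_setU => //; [apply: Sigma0_le SA|apply: Sigma0_le SB].
- by rewrite /Pi0 setCU; apply: Sigma0_setI => //; [apply: Sigma0_le PA|apply: Sigma0_le PB].
Qed.

Lemma ambiguous_belowI xi A B :
  ambiguous_below xi A -> ambiguous_below xi B -> ambiguous_below xi (A `&` B).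
Proof.
move=> aA aB; rewrite -(setCK (A `&` B)) setCI.
by apply/ambiguous_belowC/ambiguous_belowU; exact: ambiguous_belowC.
Qed.

Lemma Pi0_ambiguous_below xi eta A : (eta < xi)%O -> Pi0 eta A -> ambiguous_below xi A.
Proof.
move=> ex PA; exists eta; split=> //; first exact: Sigma0_index PA.
  exact: Pi0_Sigma0 (lt_osucc _) PA.
by apply: Pi0_le PA => //; exact/ltW/lt_osucc.
Qed.

Lemma ambiguous_below_bigcup xi (S : nat -> set T) k : (oone < xi)%O ->
  (forall i, ambiguous_below xi (S i)) -> ambiguous_below xi (\bigcup_(i in `I_k) S i).
Proof.
move=> x1 aS; elim: k => [|k IH]; last first.
  by rewrite IIS bigcup_setU bigcup_set1; exact: ambiguous_belowU.
rewrite II0 bigcup_set0; apply: Pi0_ambiguous_below x1 _.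
by apply: closed_Pi0; exact: closed0.
Qed.

Lemma ambiguous_below_bigcap xi (S : nat -> set T) k : (oone < xi)%O ->
  (forall i, ambiguous_below xi (S i)) -> ambiguous_below xi (\bigcap_(i in `I_k) S i).
Proof.
move=> x1 aS; rewrite -(setCK (bigcap _ _)) setC_bigcap; apply: ambiguous_belowC.
by apply: ambiguous_below_bigcup => // i; exact: ambiguous_belowC.
Qed.

Lemma near_lt_all (P : nat -> nat -> Prop) (n : nat) :
  (forall i, (i < n)%N -> \forall k \near \oo, P i k) ->
  \forall k \near \oo, forall i, (i < n)%N -> P i k.
Proof.
elim: n => [|n IH] h; first by apply: nearW.
have h1 := IH (fun i ni => h i (ltnW ni)); have h2 := h n (ltnSn n).
near=> k => i; rewrite ltnS leq_eqVlt => /predU1P[->|]; first by near: k.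
by move: i; near: k.
Unshelve. all: by end_near. Qed.

(* Membership in the [k]-th stage is decided by the least index [i < k] for which [x] still
   looks, at stage [k], like a point of [\bigcap_j ~` P i j] or of [\bigcap_j ~` Q i j]. *)
Definition stage_approx (P Q : nat -> nat -> set T) (k : nat) : set T :=
  \bigcup_(i in `I_k) (~` (\bigcup_(j in `I_k) P i j) `&`
    \bigcap_(i' in `I_i.+1) \bigcup_(j in `I_k) Q i' j).

(** If [x] is in [A], some [i] has [x] outside every [P i j], while the finitely many memberships
    required of the [Q i'] with [i' <= i] are seen from some stage on. If not, some [i] has [x]
    outside every [Q i j]; a witness must then lie below [i], and each of these is eventually
    refuted by [P]. *)
Lemma stage_approx_limit (P Q : nat -> nat -> set T) A :
  A = \bigcup_i ~` (\bigcup_j P i j) -> ~` A = \bigcup_i ~` (\bigcup_j Q i j) ->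
  forall x, \forall k \near \oo, stage_approx P Q k x <-> A x.
Proof.
move=> AP AQ x.
have ev (S : nat -> set T) : (\bigcup_j S j) x ->
    \forall k \near \oo, (\bigcup_(j in `I_k) S j) x.
  by move=> [j _ Sx]; exists j.+1 => // k /= jk; exists j.
have [Ax|nAx] := pselect (A x).
  have nQ i : (\bigcup_j Q i j) x.
    by apply: contrapT => h; have : (~` A) x by rewrite AQ; exists i.
  have : A x by [].
  rewrite {1}AP => -[i _ nPx].
  have evQ : \forall k \near \oo, forall i', (i' < i.+1)%N -> (\bigcup_(j in `I_k) Q i' j) x.
    by apply: near_lt_all => i' _; exact: ev.
  near=> k; split=> // _; exists i; first by near: k; exists i.+1.
  split; first by move=> [j _ Pj]; apply: nPx; exists j.
  by move=> i' /=; move: i'; near: k.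
have : (~` A) x by [].
rewrite AQ => -[i _ nQx].
have nP i' : (\bigcup_j P i' j) x.
  by apply: contrapT => h; apply: nAx; rewrite AP; exists i'.
have evP : \forall k \near \oo, forall i', (i' < i)%N -> (\bigcup_(j in `I_k) P i' j) x.
  by apply: near_lt_all => i' _; exact: ev.
near=> k; split=> // -[i0 /= _ [nPx Qx]].
have [i0i|ii0] := ltnP i0 i; last first.
  by have [j _ Qj] := Qx i ii0; case: nQx; exists j.
by case: nPx; move: i0 i0i {Qx}; near: k.
Unshelve. all: by end_near. Qed.

(** The [k]-th function separates the first [k] sets [F i] from the first [k] sets [G i]. Each point
    eventually belongs to one of these two unions, so the values at it stabilize. *)
Lemma Fsigma_open_limit (A : set T) (F G : nat -> set T) :
  (forall n, closed (F n)) -> (forall n, closed (G n)) ->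
  A = \bigcup_n F n -> ~` A = \bigcup_n G n -> baire_class oone (\1_A : T -> R).
Proof.
move=> cF cG AF AG.
have /choice[f fP] : forall k, exists f : T -> R, [/\ continuous f,
    forall x, (\bigcup_(i in `I_k) F i) x -> f x = 1 &
    forall x, (\bigcup_(i in `I_k) G i) x -> f x = 0].
  move=> k; apply: urysohn; do ?by apply: closed_bigcup.
  rewrite -subset0 => x [[i _ Fx] [j _ Gx]].
  have : (~` A) x by rewrite AG; exists j.
  by apply; rewrite AF; exists i.
apply: (@baire_class_limit _ _ _ (fun=> ozero) f) => [_|n|x].
- exact: lt_osucc.
- by apply: baire_class_continuous; case: (fP n).
apply: cvg_near_cst; rewrite indicE.
have [Ax|nAx] := pselect (A x).
  have : A x by [].
  rewrite {1}AF => -[i _ Fx]; rewrite mem_set//.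
  by exists i.+1 => // k /= ik; have [_ + _] := fP k; apply; exists i.
have : (~` A) x by [].
rewrite AG => -[i _ Gx]; rewrite memNset//.
by exists i.+1 => // k /= ik; have [_ _] := fP k; apply; exists i.
Qed.

(** Induction on [xi]. Index one is the Urysohn construction; above it, [A] and its complement are
    unions of complements of unions of sets in the algebra [ambiguous_below xi], and [stage_approx]
    turns these into sets of the algebra converging pointwise to [A]. *)
Theorem lebesgue_hausdorff_indic xi A : (oone <= xi)%O ->
  Sigma0 (osucc xi) A -> Pi0 (osucc xi) A -> baire_class xi (\1_A : T -> R).
Proof.
elim/omega1_ind: xi A => xi IH A x1.
have xS : (oone < osucc xi)%O by rewrite lt_osuccE.
have dec B : Sigma0 (osucc xi) B ->
    exists2 F : nat -> set T, B = \bigcup_n F n & forall n, Pi0 xi (F n).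
  move=> /(Sigma0_gt1P _ xS)[F [-> FP]]; exists F => // n.
  by have [e /andP[_]] := FP n; rewrite lt_osuccE => ex; exact: Pi0_le.
move=> /dec[F AF PF] /dec[G AG PG].
move: x1; rewrite le_eqVlt => /predU1P[x1|x1].
  move: PF PG; rewrite -x1 => PF PG; apply: (Fsigma_open_limit _ _ AF AG) => n.
    by rewrite -openC; apply/Sigma0_oone; exact: PF.
  by rewrite -openC; apply/Sigma0_oone; exact: PG.
have dec2 (S : nat -> set T) : (forall n, Pi0 xi (S n)) -> exists P : nat -> nat -> set T,
    (forall n, S n = ~` (\bigcup_m P n m)) /\ forall n m, ambiguous_below xi (P n m).
  move=> PS; have /choice[P PP] : forall n, exists P : nat -> set T,
      S n = ~` (\bigcup_m P m) /\ forall m, ambiguous_below xi (P m).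
    move=> n; have /(Sigma0_gt1P _ x1)[P [SP PP]] := PS n.
    exists P; rewrite -SP setCK; split=> // m.
    by have [e /andP[_ ex]] := PP m; exact: Pi0_ambiguous_below.
  by exists P; split=> n; case: (PP n).
have [P [FP aP]] := dec2 _ PF; have [Q [GQ aQ]] := dec2 _ PG.
have := @stage_approx_limit P Q A.
rewrite (_ : \bigcup_i ~` (\bigcup_j P i j) = A); last by rewrite AF; apply: eq_bigcupr.
rewrite (_ : \bigcup_i ~` (\bigcup_j Q i j) = ~` A); last by rewrite AG; apply: eq_bigcupr.
move=> /(_ erefl erefl); set D := stage_approx P Q => DA.
have /choice[eta etaP] k : ambiguous_below xi (D k).
  apply: ambiguous_below_bigcup => // i; apply: ambiguous_belowI.
    by apply: ambiguous_belowC; exact: ambiguous_below_bigcup.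
  by apply: ambiguous_below_bigcap => // i'; exact: ambiguous_below_bigcup.
apply: (@baire_class_limit _ _ _ eta (fun k => \1_(D k))) => [n|n|x].
- by case: (etaP n).
- by case: (etaP n) => *; exact: IH.
apply: cvg_near_cst; apply: filterS (DA x) => k Dk.
by rewrite !indicE; congr ((nat_of_bool _)%:R); apply/idP/idP; rewrite !inE => /Dk.
Qed.

End LebesgueHausdorff.

(** * Cantor schemes *)

Lemma uncountable_two_points (T : choiceType) (S C : set T) :
  ~ countable S -> countable C ->
  exists x y, [/\ S x, S y, ~ C x, ~ C y & x <> y].
Proof.
move=> uS cC; apply: contrapT => none; apply: uS.
have [[x [Sx nCx]]|nx] := pselect ((S `\` C) !=set0); last first.
  apply: sub_countable cC; apply: subset_card_le => y Sy.
  by apply: contrapT => nCy; apply: nx; exists y.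
have : countable (C `|` [set x]).
  rewrite -bigcup2E; apply: bigcup_countable => // -[|[|n]] _ //=.
apply: sub_countable; apply: subset_card_le => y Sy.
have [Cy|nCy] := pselect (C y); first by left.
right; apply: contrapT => yx; apply: none; exists x, y; split=> //.
by move=> xy; exact/yx/esym.
Qed.

Section CantorScheme.
Variables (R : realType) (T : topologicalType) (d : T -> T -> R).
Hypotheses (md : is_metric d) (cd : compatible_metric d) (completed : complete_metric d).
Variable B : nat -> set T.
Hypothesis basis : forall x (V : set T), nbhs x V -> exists2 n, B n x & B n `<=` V.

Let d_sym x y : d x y = d y x. Proof. by case: md. Qed.
Let d_tri x y z : d x z <= d x y + d y z. Proof. by case: md. Qed.
Let d_xx x : d x x = 0. Proof. by case: md => _ /(_ x x)[_ h] _ _; exact: h. Qed.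

(** As in the Cantor-Bendixson theorem, the basic sets with countable trace on [S] cover only
    countably many of its points; any two points left over are condensation points. *)
Lemma perfect_kernel_two_points (S : set T) : ~ countable S ->
  exists x y : T, x <> y /\ forall V : set T, (nbhs x V \/ nbhs y V) -> ~ countable (S `&` V).
Proof.
move=> uS.
pose C := \bigcup_(n in [set n | countable (S `&` B n)]) (S `&` B n).
have cC : countable C by exact: bigcup_countable.
have [x [y [Sx Sy nCx nCy xy]]] := uncountable_two_points uS cC.
exists x, y; split=> // V.
suff key z : S z -> ~ C z -> nbhs z V -> ~ countable (S `&` V).
  by move=> [|]; exact: key.
move=> Sz nCz /basis[n Bz BV] cV; apply: nCz; exists n => //=.
by apply: sub_countable cV; apply: subset_card_le; exact: setIS.
Qed.

Lemma uncountable_split (S : set T) (e : R) : closed S -> ~ countable S -> 0 < e ->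
  exists P : bool -> set T, [/\ forall b, closed (P b), forall b, ~ countable (P b),
    forall b, P b `<=` S, P true `&` P false = set0 &
    forall b x y, P b x -> P b y -> d x y <= e].
Proof.
move=> cS uS e0; have [x [y [xy uV]]] := perfect_kernel_two_points uS.
have dxy : 0 < d x y.
  case: md => ge0 eq0 _ _; rewrite lt_neqAle ge0 andbT eq_sym.
  by apply/eqP => /eq0.
(* The bound [e / 2] controls the diameters; [d x y / 3] makes the two balls disjoint. *)
pose r := Num.min (e / 2) (d x y / 3).
have r0 : 0 < r by rewrite lt_min !divr_gt0.
have re : r <= e / 2 by rewrite ge_min lexx.
have rd : r <= d x y / 3 by rewrite ge_min lexx orbT.
have nb z : nbhs z [set t | d z t <= r].
  by apply: filterS (metric_ball_nbhs cd z r0) => t /= /ltW.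
exists (fun b : bool => S `&` [set z | d (if b then x else y) z <= r]); split.
- by move=> b; apply: closedI => //; exact: closed_metric_ball.
- by move=> [|]; apply: uV; [left|right].
- by move=> b; exact: subIsetl.
- rewrite -subset0 => z [[_ /= xz] [_ /= yz]].
  have := d_tri x z y; rewrite (d_sym z y); lra.
- move=> b s t [_ /= sr] [_ /= tr].
  have := d_tri s (if b then x else y) t => h.
  by rewrite (d_sym s (if _ then _ else _)) in h; apply: le_trans h _; lra.
Qed.

Record closed_uncountable := ClosedUncountable {
  cu_set :> set T; cu_closed : closed cu_set; cu_uncountable : ~ countable cu_set }.

Lemma scheme_step : exists step : closed_uncountable -> nat -> bool -> closed_uncountable,
  forall S n, [/\ forall b, step S n b `<=` S, step S n true `&` step S n false = set0 &
    forall b x y, cu_set (step S n b) x -> cu_set (step S n b) y -> d x y <= n.+1%:R^-1].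
Proof.
suff /choice[f fP] : forall Sn : closed_uncountable * nat,
  exists P : bool -> closed_uncountable,
    [/\ forall b, P b `<=` Sn.1, P true `&` P false = set0 &
    forall b x y, cu_set (P b) x -> cu_set (P b) y -> d x y <= Sn.2.+1%:R^-1].
  by exists (fun S n => f (S, n)) => S n; exact: (fP (S, n)).
move=> [S n] /=.
have [|P [Pc Pu PS PP Pd]] :=
  @uncountable_split S n.+1%:R^-1 (@cu_closed S) (@cu_uncountable S).
  by rewrite invr_gt0.
by exists (fun b => ClosedUncountable (Pc b) (Pu b)).
Qed.

(** [P n b] is the union of the pieces at depth [n.+1] of a Cantor scheme whose last choice was [b]:
    closed as a finite union, while completeness gives each branch [c] a point. *)
Theorem independent_closed_pairs : ~ countable [set: T] ->
  exists P : nat -> bool -> set T, [/\ forall n b, closed (P n b),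
    forall n, P n true `&` P n false = set0 &
    forall c : nat -> bool, exists x, forall n, P n (c n) x].
Proof.
move=> uT; have [step stepP] := scheme_step.
pose top := ClosedUncountable closedT uT.
(* Words are stored with the latest choice at the head. *)
pose cs := fix cs (s : seq bool) : closed_uncountable :=
  if s is b :: s' then step (cs s') (size s') b else top.
have cs_eq s t x : size s = size t -> cu_set (cs s) x -> cu_set (cs t) x -> s = t.
  elim: s t => [|b s IH] [|b' t]//= [st] xs xt.
  have sb : forall u a, cs (a :: u) `<=` cs u.
    by move=> u a; case: (stepP (cs u) (size u)) => + _ _; exact.
  have {}IH : s = t by apply: IH; [|exact: sb xs|exact: sb xt].
  subst t; congr (_ :: _).
  have [_ disj _] := stepP (cs s) (size s).
  have bb (x1 : cu_set (cs (true :: s)) x) (x0 : cu_set (cs (false :: s)) x) : False.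
    by rewrite -[False]/(set0 x) -disj.
  by case: b b' xs xt => [] [] // xs xt; case: bb.
exists (fun n b => \bigcup_(s in [set s | size s = n]) cs (b :: s)); split.
- move=> n b.
  have -> : [set s : seq bool | size s = n] =
      [set` [seq tval t | t <- enum {: n.-tuple bool}]].
    apply/seteqP; split=> s /=.
      by move=> /eqP sn; apply/mapP; exists (Tuple sn) => //; rewrite mem_enum.
    by move=> /mapP[t _ ->]; rewrite size_tuple.
  by apply: closed_bigcup => [|s _]; [exact: finite_seq|exact: cu_closed].
- move=> n; rewrite -subset0 => x [[s /= sn xs] [t /= tn xt]].
  by have := @cs_eq (true :: s) (false :: t) x _ xs xt; rewrite /= sn tn => /(_ erefl).
move=> c; pose pre := fix pre n := if n is n'.+1 then c n' :: pre n' else [::].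
have size_pre n : size (pre n) = n by elim: n => //= n ->.
have pre_decr m n : (m <= n)%N -> cs (pre n) `<=` cs (pre m).
  move=> /subnK <-; elim: (n - m)%N => // k IH x; rewrite addSn => xs.
  apply: IH; move: xs.
  by case: (stepP (cs (pre (k + m)%N)) (size (pre (k + m)%N))) => + _ _; exact.
have diam n x y : cu_set (cs (pre n.+1)) x -> cu_set (cs (pre n.+1)) y -> d x y <= n.+1%:R^-1.
  have [_ _ h] := stepP (cs (pre n)) (size (pre n)).
  by move=> xs ys; have := h _ _ _ xs ys; rewrite size_pre.
have /choice[u uP] n : exists x, cu_set (cs (pre n)) x.
  apply/set0P/eqP => p0; apply: (@cu_uncountable (cs (pre n))); rewrite p0.
  exact: countable0.
(* The chosen points are Cauchy, since the nested pieces shrink; their limit stays in every piece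
   because the pieces are closed. *)
have [e e0|l ul] := completed (u := u).
  have [N _ NP] := near_infty_natSinv_lt (PosNum e0).
  exists N.+1 => m n Nm Nn; apply: le_lt_trans (NP N (leqnn N)).
  by apply: diam; [exact: pre_decr Nm _ (uP m)|exact: pre_decr Nn _ (uP n)].
exists l => n; exists (pre n) => //=.
have cl := @cu_closed (cs (pre n.+1)).
have near_u : \forall m \near \oo, cu_set (cs (pre n.+1)) (u m).
  by exists n.+1 => // m /= nm; exact: pre_decr nm _ (uP m).
exact: (@closed_cvg _ _ _ _ u _ cl near_u l ul).
Qed.

End CantorScheme.

(** * Universal sets and diagonalization *)

Definition bits := nat -> bool.

(** A single code carries a doubly indexed array of independent codes. *)
Definition code_section (c : bits) (m n : nat) : bits :=
  fun k => c (pickle (m, n, k)).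

Lemma code_of_sections (u : nat -> nat -> bits) :
  exists c, forall m n, code_section c m n = u m n.
Proof.
exists (fun p => if @unpickle (nat * nat * nat)%type p is Some (m, n, k)
  then u m n k else false).
by move=> m n; apply/funext => k; rewrite /code_section pickleK.
Qed.

Section UniversalSets.
Variable T : topologicalType.
Hypothesis open_Fsigma : forall U : set T, open U ->
  exists2 F : nat -> set T, (forall n, closed (F n)) & U = \bigcup_n F n.
Variable B : nat -> set T.
Hypothesis openB : forall n, open (B n).
Hypothesis basis : forall x (V : set T), nbhs x V -> exists2 n, B n x & B n `<=` V.
Variable K : set T.
Hypothesis closedK : closed K.

(** Continuity of [phi] on [K] into the Cantor space: each coordinate splits [K] into two relatively
    clopen parts, which are closed in [T] as [K] is. *)
Definition code_continuous (phi : T -> bits) := forall n,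
  closed (K `&` [set x | phi x n]) /\ closed (K `&` [set x | ~~ phi x n]).

Lemma code_section_continuous phi m n : code_continuous phi ->
  code_continuous (fun x => code_section (phi x) m n).
Proof. by move=> cphi k; exact: cphi. Qed.

Lemma closed_basic_union (C : set T) : closed C ->
  exists c : bits, C = \bigcap_(n in [set n | c n]) ~` B n.
Proof.
move=> cC; exists (fun n => `[< B n `<=` ~` C >]); apply/seteqP; split=> x.
  by move=> Cx n /= /asboolP BC /BC.
move=> h; apply: contrapT => nCx.
have /basis[n Bx BC] : nbhs x (~` C) by apply: open_nbhs_nbhs; split=> //; exact: closed_openC.
by apply: (h n) Bx => /=; exact/asboolP.
Qed.

(* The second clause is what a diagonal argument over [K] uses: the parameter of
   the universal set may depend continuously on the point. *)
Definition universal_Pi0 (xi : omega1) (P : bits -> set T) :=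
  (forall A, Pi0 xi A -> exists c, P c = A) /\
  (forall phi, code_continuous phi -> Pi0 xi (K `&` [set x | P (phi x) x])).

Lemma universal_Pi0_oone : universal_Pi0 oone (fun c => \bigcap_(n in [set n | c n]) ~` B n).
Proof.
split=> [A PA|phi cphi].
  have [|c ->] := @closed_basic_union A; last by exists c.
  by rewrite -openC; apply/Sigma0_oone.
apply: closed_Pi0.
(* Coordinate by coordinate: either bit [n] is off, a closed condition on [K], or [x] avoids the
   open set [B n]. *)
rewrite (_ : _ `&` _ = \bigcap_n (K `&` [set x | ~~ phi x n] `|` K `&` ~` B n)).
  apply: closed_bigI => n _; apply: closedU; first by case: (cphi n).
  by apply: closedI => //; exact: open_closedC.
apply/seteqP; split=> x.
  move=> [Kx h] n _; have [pn|pn] := boolP (phi x n); last by left.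
  by right; split=> //; exact: h.
move=> h; split; first by have [[]|[]] := h 0%N I.
by move=> n /= pn; have [[_ /=]|[_]//] := h n I; rewrite pn.
Qed.

(** Countably many classes lie below [xi], enumerated by [en]. Section [(m, n)] of a code is read in
    a universal set of class [en m], and the complements of the sets so coded are intersected. *)
Theorem exists_universal_Pi0 xi : (oone <= xi)%O -> exists P, universal_Pi0 xi P.
Proof.
elim/omega1_ind: xi => xi IH; rewrite le_eqVlt => /predU1P[<-|x1].
  by eexists; exact: universal_Pi0_oone.
pose D := [set e : omega1 | (oone <= e < xi)%O].
have cD : countable D.
  by apply: sub_countable (omega1_countable_segment xi); apply: subset_card_le => e /andP[].
have [|en Den] := countable_eq_range cD; first by exists oone; rewrite /D /= lexx.
have Dn m : D (en m) by rewrite Den; exists m.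
have /choice[P PP] m : exists P, universal_Pi0 (en m) P.
  by have /andP[? ?] := Dn m; exact: IH.
exists (fun c => \bigcap_m \bigcap_n ~` P m (code_section c m n)); split.
- move=> A /(Sigma0_gt1P _ x1)[F [AF FP]].
  have /choice[mn mnP] n : exists m, Pi0 (en m) (F n).
    have [e De Fe] := FP n; have [m _ me] : range en e by rewrite -Den.
    by exists m; rewrite me.
  (* [F n] is coded only at the class [mn n] assigned to it; elsewhere the empty set is coded, whose
     complement imposes no condition. *)
  have /choice[u uP] mk : exists c, P mk.1 c = if mk.1 == mn mk.2 then F mk.2 else set0.
    have [+ _] := PP mk.1; apply; case: eqP => [->//|_].
    by apply: Pi0_le (closed_Pi0 (@closed0 T)) => //; case/andP: (Dn mk.1).
  have {}uP m n : P m (u (m, n)) = if m == mn n then F n else set0 := uP (m, n).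
  have [c cP] := code_of_sections (fun m n => u (m, n)).
  exists c; rewrite -[RHS]setCK AF setC_bigcup.
  apply/seteqP; split=> x h m _.
    by have := h (mn m) I m I; rewrite cP uP eqxx.
  by move=> n _; rewrite cP uP; case: eqP => [_|_ []]; exact: h.
move=> phi cphi; rewrite /Pi0.
rewrite (_ : ~` _ = ~` K `|` \bigcup_m \bigcup_n
    (K `&` [set x | P m (code_section (phi x) m n) x])).
  apply: Sigma0_setU => //.
    by apply: open_Sigma0 => //; [exact: ltW|exact: closed_openC].
  apply: Sigma0_bigcup_nat => // m; apply: Sigma0_bigcup_nat => // n.
  have /andP[_ mx] := Dn m; apply: Pi0_Sigma0 mx _.
  by have [_] := PP m; apply; exact: code_section_continuous.
apply/seteqP; split=> x.
  move=> h; have [Kx|] := pselect (K x); last by left.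
  right; apply: contrapT => h'; apply: h; split=> // m _ n _ Px.
  by apply: h'; exists m => //; exists n.
by move=> [nK [] //|[m _ [n _ [Kx Px]]] [_ /(_ m I n I)]].
Qed.

End UniversalSets.

(** * The diagonal set and its rank *)

Section Diagonal.
Variables (R : realType) (T : topologicalType).
Hypothesis open_Fsigma : forall U : set T, open U ->
  exists2 F : nat -> set T, (forall n, closed (F n)) & U = \bigcup_n F n.
Variables (K : set T) (g : T -> bits).
Hypothesis closedK : closed K.
Hypothesis g_continuous : code_continuous K g.
Hypothesis g_onto : forall c, exists2 x, K x & g x = c.
Variables (xi : omega1) (P : bits -> set T).
Hypothesis xi1 : (oone <= xi)%O.
Hypothesis universalP : universal_Pi0 K xi P.

Lemma Pi0_set0 : Pi0 xi (@set0 T).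
Proof. by apply: Pi0_le (closed_Pi0 (@closed0 T)). Qed.

(* A point [x] of [K] codes, through [g], a sequence of sets of length [zeta]; [x] is put into
   [G theta] exactly when it belongs to the set of index [theta] that it codes. *)
Lemma diagonal_seq (zeta : omega1) : exists G : omega1 -> set T,
  [/\ forall theta, Pi0 xi (G theta),
      forall theta, (zeta <= theta)%O -> G theta = set0 &
      forall S : omega1 -> set T, (forall theta, (theta < zeta)%O -> Pi0 xi (S theta)) ->
        exists x, forall theta, (theta < zeta)%O -> G theta x <-> S theta x].
Proof.
have /countable_injP[f finj] := omega1_countable_segment zeta.
have [Puniv Pdiag] := universalP.
exists (fun theta => if (theta < zeta)%O
  then K `&` [set x | P (code_section (g x) (f theta) 0) x] else set0); split.
- move=> t; case: ifP => _; last exact: Pi0_set0.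
  by apply: Pdiag; exact: code_section_continuous.
- by move=> t zt; rewrite ltNge zt.
move=> S PS.
(* By injectivity of [f] at most one index below [zeta] is sent to [m]; the constant code serves
   when there is none. *)
have /choice[u uP] m : exists c, forall t, (t < zeta)%O -> f t = m -> P c = S t.
  have [[t [tz ft]]|nt] := pselect (exists t, (t < zeta)%O /\ f t = m).
    have [c cP] := Puniv _ (PS t tz); exists c => s sz fs.
    by rewrite cP; congr S; apply: finj; rewrite ?inE// fs.
  by exists (fun=> false) => t tz ft; case: nt; exists t.
have [c cP] := code_of_sections (fun m _ => u m).
have [x Kx gx] := g_onto c; exists x => t tz; rewrite tz /= gx cP.
by rewrite (uP _ t tz erefl); split=> [[]|].
Qed.

Theorem alpha_rank_indic_ge (zeta : omega1) : exists A : set T,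
  [/\ Sigma0 (osucc xi) A, Pi0 (osucc xi) A & (zeta <= alpha_rank xi (\1_A : T -> R))%O].
Proof.
have [G [PG G0 Gdiag]] := diagonal_seq zeta.
pose E := ocap G; pose A := even_difference E.
have E0 t : (osucc zeta <= t)%O -> E t = set0.
  by rewrite osucc_leE -subset0 => zt x /(_ _ zt); rewrite G0.
have EE0 t : (osucc (osucc zeta) <= t)%O -> ocap E t = set0.
  by rewrite osucc_leE -subset0 => zt x /(_ _ zt); rewrite E0.
have PE t : Pi0 xi (E t) by exact: ocap_Pi0.
have PEE t : Pi0 xi (ocap E t) by exact: ocap_Pi0.
have AC : ~` A = even_difference (ocap E) := setC_even_difference_ocap G0.
exists A; split.
- exact: even_difference_Sigma0 E0 PE.
- by rewrite /Pi0 AC; exact: even_difference_Sigma0 EE0 PEE.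
(* The pair [p = 0], [q = 1] suffices: its two sets are the complement of [A] and [A], so a
   separating difference must equal the complement of [A]. Countably many pairs of rationals keep
   the supremum bounded. *)
apply: (@le_supremum _ _ (alpha_sep xi (~` A) A)).
- apply: countable_has_ubound.
  apply: (@sub_countable _ _ _ [set: rat * rat]%type); last exact: countableP.
  apply: (@card_le_trans _ _ _ (range (fun pq : rat * rat =>
    alpha_sep xi [set x | (\1_A : T -> R) x <= ratr pq.1]
      [set x | ratr pq.2 <= (\1_A : T -> R) x]))).
    by apply: subset_card_le => a [p [q [pq ->]]]; exists (p, q).
  exact: card_image_le.
- have r0 : ratr 0 = 0 :> R := rmorph0 _; have r1 : ratr 1 = 1 :> R := rmorph1 _.
  exists 0, 1; split=> //; congr alpha_sep; rewrite ?r0 ?r1; apply/seteqP; split=> x /=.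
  + by move=> nAx; rewrite indicE memNset.
  + by move=> + Ax; rewrite indicE mem_set// ler10.
  + by move=> Ax; rewrite indicE mem_set.
  + by move=> h; apply: contrapT => nAx; move: h; rewrite indicE memNset// ler10.
rewrite /alpha_sep; set L := (X in omin X).
(* [ocap E] has the complement of [A] as its difference, so [omin L] is a true minimum. *)
have /ominP[] : L !=set0.
  exists (osucc (osucc zeta)), (ocap E); split=> //.
  - exact: ocap_continuous_decreasing.
  - by rewrite (transfinite_difference_even EE0) -AC.
  - by rewrite (transfinite_difference_even EE0) -AC.
move=> [F [cF PF AF FA]] _; rewrite leNgt; apply/negP; set l := omin L in cF PF AF FA *.
move=> lz.
have F0 t : (l <= t)%O -> F t = set0 by case: cF => -[_ +] _ _ _; exact.
rewrite (transfinite_difference_even F0) in AF FA.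
(* The point [x] codes the successor values of [F], which are empty from the length [l] on. *)
have [t tz|x xP] := Gdiag (fun t => F (osucc t)).
  have [sl|ls] := ltP (osucc t) l; first exact: PF.
  by rewrite F0//; exact: Pi0_set0.
have EF : forall e, E e x <-> F e x.
  move=> e; rewrite (continuous_decreasing_ocap cF).
  have GF t : G t x <-> F (osucc t) x.
    have [tz|zt] := ltP t zeta; first exact: xP.
    (* From [zeta] on both sides are empty, because [l < zeta]. *)
    by rewrite G0// F0//; apply/ltW/(lt_trans lz)/(le_lt_trans zt)/lt_osucc.
  by split=> h t /h /GF.
have AxF : A x <-> even_difference F x.
  by split=> -[e ee [h1 h2]]; exists e => //; split; by [apply/EF|move/EF].
have [Ax|nAx] := pselect (A x); first by apply: (FA x) (Ax); exact/AxF.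
by apply: (nAx); apply/AxF; exact: AF.
Qed.

End Diagonal.

(** A point of [K] lies in exactly one set of each pair, and [g] records which. Both values of a
    coordinate cut out closed parts of [K], and independence of the pairs makes [g] onto. *)
Lemma closed_pairs_code (T : topologicalType) (C : nat -> bool -> set T) :
  (forall n b, closed (C n b)) -> (forall n, C n true `&` C n false = set0) ->
  (forall c : bits, exists x, forall n, C n (c n) x) ->
  exists (K : set T) (g : T -> bits), [/\ closed K, code_continuous K g &
    forall c, exists2 x, K x & g x = c].
Proof.
move=> clC disj indep; pose K := \bigcap_n (C n true `|` C n false).
have clK : closed K by apply: closed_bigI => n _; exact: closedU.
have nC n x : C n true x -> C n false x -> False.
  by move=> h1 h2; have : (C n true `&` C n false) x by []; rewrite disj.
exists K, (fun x n => `[< C n true x >]); split=> // [n|c].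
- split.
    rewrite (_ : _ `&` _ = K `&` C n true); first exact: closedI.
    by apply/seteqP; split=> x [Kx] => [/asboolP|Cx]; split=> //; exact/asboolP.
  rewrite (_ : _ `&` _ = K `&` C n false); first exact: closedI.
  apply/seteqP; split=> x [Kx] => [/asboolPn nCx|Cx]; split=> //.
    by have [] := Kx n I.
  by apply/asboolPn => /nC; apply.
have [x xP] := indep c; exists x.
  by move=> n _; have := xP n; case: (c n); [left|right].
apply/funext => n; have := xP n; case: (c n) => Cx; first exact/asboolP.
by apply/asboolPn => /nC; apply.
Qed.

Theorem theorem4p3 (R : realType) (X : topologicalType) (xi : omega1)
    (hX : polish R X) (hunc : ~ countable [set: X]) (hxi : (oone <= xi)%O)
    (zeta : omega1) :
  exists A : set X,
    baire_class xi (\1_A : X -> R) /\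
    (zeta <= alpha_rank xi (\1_A : X -> R))%O.
Proof.
case: hX => sepX [d [md cd compl]].
have X0 : [set: X] !=set0.
  by apply/set0P/eqP => X0; apply: hunc; rewrite X0; exact: countable0.
have [B openB basis] := separable_countable_base md cd sepX X0.
have Fs := metric_open_Fsigma md cd.
have [C [clC disj indep]] := independent_closed_pairs md cd compl basis hunc.
have [K [g [clK gK gsurj]]] := closed_pairs_code clC disj indep.
have [P Puniv] := exists_universal_Pi0 Fs openB basis clK hxi.
have [A [SA PA rankA]] := alpha_rank_indic_ge R Fs gK gsurj hxi Puniv zeta.
exists A; split=> //.
exact: (lebesgue_hausdorff_indic Fs (metric_urysohn md cd)).
Qed.
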